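(* Let $\mathfrak{M}$ be a von Neumann algebra and let $A\in\mathfrak{M}$ be nonzero and positive. The following are equivalent. (1) $\sigma_A(T)$ is finite for any $T\in\mathfrak{M}^A$. (2) $A$ is in the socle of $\mathfrak{M}$.
   Context: $\mathfrak{M}$ acts on a complex Hilbert space $\mathcal{H}$ and contains the identity $I$. For $h\in\mathcal{H}$ put $\|h\|_A=\sqrt{\langle Ah,h\rangle}$, for $T\in\mathfrak{M}$ put $\|T\|_A=\sup\{\|Th\|_A:\|h\|_A=1\}$, and set $\mathfrak{M}^A=\{T\in\mathfrak{M}:\|T\|_A<\infty\}$. $T\in\mathfrak{M}^A$ is $A$-invertible in $\mathfrak{M}^A$ if there is $S\in\mathfrak{M}^A$ with $ATS=AST=A$; the $A$-spectrum is $\sigma_A(T)=\{\lambda\in\mathbb{C}:\lambda I-T\text{ is not }A\text{-invertible in }\mathfrak{M}^A\}$. The socle of $\mathfrak{M}$ is the sum of all minimal left (equivalently, right) ideals of $\mathfrak{M}$ (it is $\{0\}$ if there are none). *)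

(* Defs.v *)
From HB Require Import structures.
From mathcomp Require Import all_boot all_order all_algebra.
From mathcomp Require Import all_classical all_reals all_analysis.
From mathcomp Require Import complex.

Set Implicit Arguments.
Unset Strict Implicit.
Unset Printing Implicit Defensive.

Import Order.TTheory GRing.Theory Num.Theory.
Import numFieldNormedType.Exports.

Local Open Scope classical_set_scope.
Local Open Scope ring_scope.
Local Open Scope complex_scope.

(* Operators on H are plain functions H -> H, with the pointwise lmodType
   structure of mathcomp-analysis; their product is composition and I is
   idfun.  Inner products are linear in the first argument. *)

Section Operators.
Context {R : realType} {H : completeNormedModType R[i]}.
Variable ip : {dot H for Num.conj}.

(* The norm of the Banach space H is the one given by ip, so that (H, ip) is a
   Hilbert space. *)
Definition hilbert_space : Prop := forall h : H, `|h| ^+ 2 = ip h h.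

Definition bounded_operator : set (H -> H) :=
  [set T | linear T /\ continuous T].

Definition adjoint_of (T S : H -> H) : Prop :=
  forall h k : H, ip (T h) k = ip h (S k).

(* In R[i], 0 <= z means that z is real and nonnegative. *)
Definition positive_operator (T : H -> H) : Prop :=
  forall h : H, 0 <= ip (T h) h.

(* A strongly closed unital *-subalgebra of B(H): the strong operator topology
   is the topology of pointwise convergence on B(H), and closedness is relative
   to B(H). *)
Record von_neumann_algebra (M : set (H -> H)) : Prop := VonNeumannAlgebra {
  vna_bounded : M `<=` bounded_operator ;
  vna_one : M idfun ;
  vna_linear : forall (c : R[i]) S T, M S -> M T -> M (c *: S + T) ;
  vna_comp : forall S T, M S -> M T -> M (S \o T) ;
  vna_adjoint : forall T, M T -> exists2 S, M S & adjoint_of T S ;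
  vna_closed :
    closure (M : set {ptws H -> H}) `&` bounded_operator `<=` M
}.

(* For A positive, ip (A h) h is a nonnegative real, and Re only changes its
   type. *)
Definition Anorm (A : H -> H) (h : H) : R :=
  Num.sqrt (complex.Re (ip (A h) h)).

Definition Aopnorm (A T : H -> H) : \bar R :=
  ereal_sup [set (Anorm A (T h))%:E | h in [set h | Anorm A h = 1]].

Definition Abounded (M : set (H -> H)) (A : H -> H) : set (H -> H) :=
  [set T | M T /\ (Aopnorm A T < +oo)%E].

Definition Ainvertible (M : set (H -> H)) (A T : H -> H) : Prop :=
  exists2 S, Abounded M A S & A \o T \o S = A /\ A \o S \o T = A.

Definition Aspectrum (M : set (H -> H)) (A T : H -> H) : set R[i] :=
  [set l : R[i] | ~ Ainvertible M A (l *: idfun - T)].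

End Operators.

Section Socle.
Context {R : realType} {H : completeNormedModType R[i]}.
Variable M : set (H -> H).

Record left_ideal (J : set (H -> H)) : Prop := LeftIdeal {
  lideal_sub : J `<=` M ;
  lideal0 : J 0 ;
  lideal_linear : forall (c : R[i]) X Y, J X -> J Y -> J (c *: X + Y) ;
  lideal_comp : forall S X, M S -> J X -> J (S \o X)
}.

Definition minimal_left_ideal (J : set (H -> H)) : Prop :=
  [/\ left_ideal J, J <> [set 0] &
      forall K, left_ideal K -> K `<=` J -> K = [set 0] \/ K = J].

Definition socle : set (H -> H) :=
  [set T | exists (n : nat) (X : 'I_n -> H -> H),
    (forall i, exists2 J, minimal_left_ideal J & J (X i)) /\
    T = \sum_(i < n) X i].

End Socle.

(* Main.v *)
From HB Require Import structures.
Require Import Defs.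
From mathcomp Require Import all_boot all_order all_algebra.
From mathcomp Require Import all_classical all_reals all_analysis.
From mathcomp Require Import complex.
From mathcomp Require Import ring lra.
Import Order.TTheory GRing.Theory Num.Theory.
Import numFieldNormedType.Exports.
Local Open Scope classical_set_scope.
Local Open Scope ring_scope.
Local Open Scope complex_scope.
Set Implicit Arguments.
Unset Strict Implicit.
Unset Printing Implicit Defensive.

(** Both implications come down to finding polynomials that kill operators.

    The one analytic fact about spectra is [norm_square_spectral]: if b is
    self-adjoint and nonzero and N is the square of its norm, then b is not
    of the form L (b^2 - N) with L bounded, because b^2 - N is almost zero
    on unit vectors that almost attain the norm of b. The algebraic
    counterpart is [algebraic_regular]: a self-adjoint b killed by a nonzero
    polynomial satisfies b = s b^2 with s in M. Then s b is the projection
    on the closed range of b ([support_projection]), and it lies in every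
    left ideal that contains b.

    From the socle to finite spectra. A minimal left ideal J contains some
    nonzero a = x^* x; minimality gives a = s a^2, so J = M q for a
    projection q. Nonzero elements of q M q have left inverses in M relative
    to q, but for nonzero self-adjoint b in q M q the element b^2 - N q has
    none, so that b^2 = N q. Factoring this as a difference of squares gives
    b = sqrt N q or b = - sqrt N q, whence q M q consists of scalar
    multiples of q and p M q has dimension at most one for two such
    projections. Writing A = A^* as a sum of elements of minimal left ideals
    shows that A M A has finite dimension ([socle_sandwich]). Hence the
    powers of A are linearly dependent and A = s A^2. An A-bounded T
    preserves the kernel of A, so that A T^k = A T^k s A lies in A M A for
    all k, and a linear dependence gives a nonzero f with A f(T) = 0.
    Dividing f(z) - f by z - X shows that the A-spectrum of T consists of
    roots of f.

    From finite spectra to the socle. All of M A is A-bounded. Let b in M A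
    be self-adjoint with finite A-spectrum. For z nonzero outside the
    A-spectrum, b - z has a left inverse in M. Let f have 0 and the points
    of the A-spectrum among its roots, and real coefficients. If c = f(b)
    were nonzero, then c^2 - N would be a multiple of a product of such
    factors b - z and have a left inverse, which contradicts
    [norm_square_spectral]; so f(b) = 0 and b = s b^2
    ([selfadjoint_regular]). Therefore each nonzero left ideal inside M A
    contains a nonzero projection. If the support projection of A were
    outside the socle, it could be split again and again into two orthogonal
    nonzero projections of which one is again outside the socle. This
    produces pairwise orthogonal nonzero projections r_n below it, and the
    sum of the 2^-n r_n is an element of M A with each 2^-n in its
    A-spectrum. *)

(** * Linear maps and quadratic forms *)

Section LinearMaps.
Context {R : realType} {H : completeNormedModType R[i]}.
Implicit Types (T : H -> H) (x y : H).

Lemma lopD T x y : linear T -> T (x + y) = T x + T y.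
Proof. by move=> lT; have := lT 1 x y; rewrite !scale1r. Qed.

Lemma lop0 T : linear T -> T 0 = 0.
Proof.
by move=> lT; have := lT (-1) 0 0; rewrite scaler0 addr0 scaleN1r addNr.
Qed.

Lemma lopZ T c x : linear T -> T (c *: x) = c *: T x.
Proof. by move=> lT; have := lT c x 0; rewrite (lop0 lT) !addr0. Qed.

Lemma lopN T x : linear T -> T (- x) = - T x.
Proof. by move=> lT; rewrite -scaleN1r lopZ // scaleN1r. Qed.

Lemma lopB T x y : linear T -> T (x - y) = T x - T y.
Proof. by move=> lT; rewrite lopD // lopN. Qed.

Lemma lop_sum T I (r : seq I) (P : pred I) (F : I -> H) :
  linear T -> T (\sum_(i <- r | P i) F i) = \sum_(i <- r | P i) T (F i).
Proof.
move=> lT; elim/big_rec2: _ => [|i y1 y2 _ <-]; first exact: lop0.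
exact: lopD.
Qed.

Lemma sum_opE I (r : seq I) (P : pred I) (F : I -> H -> H) x :
  (\sum_(i <- r | P i) F i) x = \sum_(i <- r | P i) F i x.
Proof. by elim/big_rec2: _ => // i y1 y2 _ <-. Qed.

(** Gives access to the library results on bundled linear maps. *)
Lemma linear_pack T : linear T -> exists T' : {linear H -> H}, T = T'.
Proof.
move=> lT.
pose mixin := GRing.isLinear.Build _ _ _ _ T lT.
pose T' : {linear H -> H} := HB.pack T mixin.
by exists T'.
Qed.

End LinearMaps.

Section QuadraticForms.
Context {R : realType} {H : completeNormedModType R[i]}.
Variable ip : {dot H for Num.conj}.
Implicit Types (A T : H -> H) (x y : H) (c : R[i]).

Lemma ipC x y : ip y x = (ip x y)^*%R.
Proof. by rewrite (hermC ip) /= expr0 mul1r. Qed.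

Lemma Re_ipC x y : complex.Re (ip y x) = complex.Re (ip x y).
Proof. by rewrite ipC; case: (ip x y). Qed.

Definition qf A x : R := complex.Re (ip (A x) x).
Definition sqn x : R := complex.Re (ip x x).
Definition abs2 c : R := complex.Re c ^+ 2 + complex.Im c ^+ 2.

Lemma abs2E c : c * c^*%R = (abs2 c)%:C.
Proof. case: c => a b; rewrite /abs2 /=; simpc; congr (_ +i* _); ring. Qed.

Lemma abs2_ge0 c : 0 <= abs2 c.
Proof. by rewrite /abs2 addr_ge0 ?sqr_ge0. Qed.

Lemma abs2_real (t : R) : abs2 t%:C = t ^+ 2.
Proof. by rewrite /abs2 /= expr0n /= addr0. Qed.

Lemma conj_real (t : R) : (t%:C)^*%R = t%:C.
Proof. exact: conjc_real. Qed.

Lemma Re_mulR (t : R) c : complex.Re (t%:C * c) = t * complex.Re c.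
Proof. by case: c => a b /=; rewrite mul0r subr0. Qed.

Lemma ge0_ReE c : 0 <= c -> c = (complex.Re c)%:C.
Proof. by case: c => a b; rewrite lecE /= => /andP[/eqP ->]. Qed.

Lemma sqnE x : ip x x = (sqn x)%:C.
Proof. exact/ge0_ReE/dnorm_ge0. Qed.

Lemma sqn_ge0 x : 0 <= sqn x.
Proof. by rewrite -ler0c -sqnE dnorm_ge0. Qed.

Lemma sqn_eq0 x : sqn x = 0 -> x = 0.
Proof. by move=> x0; apply/eqP; rewrite -(dnorm_eq0 ip) sqnE x0. Qed.

Lemma qfZ A c x : linear A -> qf A (c *: x) = abs2 c * qf A x.
Proof.
move=> lA; rewrite /qf lopZ // linearZl_LR linearZr_LR /= mulrA abs2E.
exact: Re_mulR.
Qed.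

Lemma qfD A x y : linear A -> adjoint_of ip A A ->
  qf A (x + y) = qf A x + qf A y + 2 * complex.Re (ip (A x) y).
Proof.
move=> lA aA; rewrite /qf lopD // linearDl !linearDr /= !raddfD /=.
have -> : complex.Re (ip (A y) x) = complex.Re (ip (A x) y).
  by rewrite aA Re_ipC.
by ring.
Qed.
End QuadraticForms.

(** * Bounded operators and their norms *)

Section BoundedOperators.
Context {R : realType} {H : completeNormedModType R[i]}.
Variable ip : {dot H for Num.conj}.
Implicit Types (A T : H -> H) (x y : H) (c : R[i]).
Notation sqn := (sqn ip).
Notation qf := (qf ip).

Lemma sqn_qf x : sqn x = qf idfun x. Proof. by []. Qed.

Lemma sqnZ c x : sqn (c *: x) = abs2 c * sqn x.
Proof. by rewrite sqn_qf qfZ. Qed.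

Lemma sqnD x y : sqn (x + y) = sqn x + sqn y + 2 * complex.Re (ip x y).
Proof. by rewrite sqn_qf qfD. Qed.

Lemma abs2N1 : abs2 (-1 : R[i]) = 1.
Proof. by rewrite /abs2 /= oppr0 expr0n addr0 sqrrN expr1n. Qed.

(** The parallelogram inequality, which serves as triangle inequality for the
    seminorm h |-> sqrt (qf A h). *)
Lemma qfD_le A x y : linear A -> adjoint_of ip A A ->
  (forall z, 0 <= qf A z) -> qf A (x + y) <= 2 * qf A x + 2 * qf A y.
Proof.
move=> lA aA A0; have := A0 (x - y).
rewrite -scaleN1r !qfD // qfZ // abs2N1 mul1r scaleN1r linearNr raddfN /=.
lra.
Qed.

(** Boundedness is measured on squares of norms, which are the values of a
    quadratic form and avoid square roots. *)
Definition bnd T := exists2 C : R, 0 <= C & forall h, sqn (T h) <= C * sqn h.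

Lemma bounded_operatorP T : hilbert_space ip ->
  bounded_operator T <-> linear T /\ bnd T.
Proof.
move=> hs; have nE h : `|h| ^+ 2 = (sqn h)%:C by rewrite hs sqnE.
split=> [[lT cT]|[lT [C C0 bT]]]; (split; first exact: lT);
  have [T' TE] := linear_pack lT; subst T.
  move: cT => /linear_bounded_continuous /linear_boundedP bT.
  near +oo_R[i] => r.
  have r0 : 0 <= r by near: r; apply: nbhs_pinfty_ge.
  have br h : `|T' h| <= r * `|h| by move: h; near: r.
  exists (complex.Re r ^+ 2) => [|h]; first exact: sqr_ge0.
  have : `|T' h| ^+ 2 <= (r * `|h|) ^+ 2 by rewrite ler_pXn2r ?nnegrE ?mulr_ge0.
  by rewrite exprMn !nE (ge0_ReE r0) -rmorphXn -rmorphM /= lecR.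
apply/linear_bounded_continuous/linear_boundedP.
near=> r => h.
have r0 : 0 <= r by near: r; apply: nbhs_pinfty_ge; rewrite ?rpred0.
have rC : (Num.sqrt C)%:C <= r.
  by near: r; apply: nbhs_pinfty_ge; apply/complex_realP; exists (Num.sqrt C).
apply: (@le_trans _ _ ((Num.sqrt C)%:C * `|h|)); last exact: ler_wpM2r.
have sC0 : 0 <= (Num.sqrt C)%:C :> R[i] by rewrite ler0c sqrtr_ge0.
rewrite -(@ler_pXn2r _ 2) ?nnegrE ?mulr_ge0 // exprMn !nE.
by rewrite -rmorphXn sqr_sqrtr // -rmorphM lecR.
Unshelve. all: by end_near. Qed.

(** N is the square of the operator norm of T. *)
Lemma opnorm T : bnd T -> exists2 N : R,
  0 <= N /\ (forall h, sqn (T h) <= N * sqn h) &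
  forall C, 0 <= C -> (forall h, sqn (T h) <= C * sqn h) -> N <= C.
Proof.
move=> [C0 C00 bT].
pose E := [set C : R | 0 <= C /\ forall h, sqn (T h) <= C * sqn h].
have E0 : E C0 by [].
have lbE : lbound E 0 by move=> C [].
have hE : has_inf E by split; [exists C0 | exists 0].
exists (inf E) => [|C C1 bC]; last by apply: ge_inf => //; exists 0.
split=> [|h]; first by apply: lb_le_inf; [exists C0|].
have := sqn_ge0 ip h; rewrite le_eqVlt => /orP[/eqP/esym h0|h0].
  by have := bT h; rewrite h0 !mulr0.
rewrite -ler_pdivrMr //; apply: lb_le_inf; first by exists C0.
by move=> C [_ /(_ h)]; rewrite ler_pdivrMr.
Qed.

(** With sqn (L h) <= K sqn h, a factorization b = L (b^2 - N) would give
      sqn (b h) <= K (sqn (b^2 h) - 2 N sqn (b h) + N^2 sqn h)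
                <= K N (N sqn h - sqn (b h)),
    so that K N^2 / (1 + K N) < N would bound sqn (b h) / sqn h, contrary to the
    minimality of N. *)
Lemma norm_square_spectral b :
    linear b -> adjoint_of ip b b -> bnd b -> b <> 0 ->
  exists2 N : R, 0 < N &
  forall L, bnd L -> ~ forall h, b h = L (b (b h) - N%:C *: h).
Proof.
move=> lb ab /opnorm[N [N0 bN] minN] b0.
have Ngt0 : 0 < N.
  rewrite lt_def N0 andbT; apply/eqP => N00; apply: b0; apply/funext => h.
  apply: (@sqn_eq0 _ _ ip); apply/eqP; rewrite eq_le sqn_ge0 andbT.
  by have := bN h; rewrite N00 mul0r.
exists N => // L [K K0 bL] bE.
have KN : 0 < 1 + K * N by rewrite ltr_wpDr ?mulr_ge0.
have : N <= K * N ^+ 2 / (1 + K * N).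
  apply: minN => [|h]; first by rewrite divr_ge0 ?mulr_ge0 ?sqr_ge0 // ltW.
  rewrite mulrAC ler_pdivlMr //.
  have := bL (b (b h) - N%:C *: h); rewrite -bE => le1.
  have eq1 : sqn (b (b h) - N%:C *: h) =
      sqn (b (b h)) + N ^+ 2 * sqn h - 2 * N * sqn (b h).
    rewrite -scaleNr -rmorphN sqnD sqnZ abs2_real sqrrN linearZr_LR /=.
    rewrite conj_real Re_mulR.
    by rewrite ab -/(sqn (b h)); ring.
  rewrite {}eq1 in le1; have := bN (b h) => le2.
  have le3 : K * sqn (b (b h)) <= K * (N * sqn (b h)) by rewrite ler_wpM2l.
  nra.
rewrite ler_pdivlMr // => le1.
have : N <= 0 by nra.
by rewrite leNgt Ngt0.
Qed.

End BoundedOperators.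

(** * Adjoints and polynomials in an operator *)

Section OperatorPolynomials.
Context {R : realType} {H : completeNormedModType R[i]}.
Variable ip : {dot H for Num.conj}.
Implicit Types (S T b : H -> H) (x y h : H) (c : R[i]) (p q : {poly R[i]}).

Lemma ip_inj x y : (forall z, ip z x = ip z y) -> x = y.
Proof.
move=> xy; apply/eqP; rewrite -subr_eq0 -(dnorm_eq0 ip).
by rewrite linearBr /= xy subrr.
Qed.

Lemma adjoint_unique T S S' : adjoint_of ip T S -> adjoint_of ip T S' -> S = S'.
Proof. by move=> TS TS'; apply/funext => x; apply: ip_inj => z; rewrite -TS. Qed.

Lemma adjoint_sym T S : adjoint_of ip T S -> adjoint_of ip S T.
Proof. by move=> TS x y; rewrite ipC -TS -ipC. Qed.

Lemma adjoint_comp S S' T T' : adjoint_of ip S S' -> adjoint_of ip T T' ->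
  adjoint_of ip (S \o T) (T' \o S').
Proof. by move=> SS TT x y; rewrite /= SS TT. Qed.

Lemma adjointD S S' T T' : adjoint_of ip S S' -> adjoint_of ip T T' ->
  adjoint_of ip (S + T) (S' + T').
Proof. by move=> SS TT x y; rewrite linearDl linearDr /= SS TT. Qed.

Lemma adjointZ c T T' : adjoint_of ip T T' ->
  adjoint_of ip (c *: T) (c^*%R *: T').
Proof. by move=> TT x y; rewrite linearZl_LR linearZr_LR /= TT conjCK. Qed.

Lemma adjointB S S' T T' : adjoint_of ip S S' -> adjoint_of ip T T' ->
  adjoint_of ip (S - T) (S' - T').
Proof. by move=> SS TT x y; rewrite linearBl linearBr /= SS TT. Qed.

Lemma adjoint_sum I (r : seq I) (F F' : I -> H -> H) :
  (forall i, adjoint_of ip (F i) (F' i)) ->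
  adjoint_of ip (\sum_(i <- r) F i) (\sum_(i <- r) F' i).
Proof.
move=> FF; elim/big_rec2: _ => [|i S S' _ SS]; last exact: adjointD.
by move=> x y; rewrite linear0l linear0r.
Qed.

(** The kernel of a self-adjoint operator does not grow with its powers. *)
Lemma selfadjoint_cancel b h : adjoint_of ip b b -> b (b h) = 0 -> b h = 0.
Proof. by move=> ab bb; apply/eqP; rewrite -(dnorm_eq0 ip) ab bb linear0r. Qed.

(** Plain maps H -> H do not form a ring under composition, so evaluation at b is
    spelled out on vectors. *)
Definition opoly b p : H -> H := fun h => \sum_(i < size p) p`_i *: iter i b h.

Lemma opoly_wide n b p h : (size p <= n)%N ->
  opoly b p h = \sum_(i < n) p`_i *: iter i b h.
Proof.
move=> pn; rewrite /opoly (big_ord_widen _ (fun i => p`_i *: iter i b h) pn).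
rewrite [RHS](bigID (fun i : 'I_n => (i < size p)%N)) /=.
rewrite [X in _ + X]big1 ?addr0 //.
by move=> i; rewrite -leqNgt => /(nth_default 0) ->; rewrite scale0r.
Qed.

Lemma opoly_linear b c p q h :
  opoly b (c *: p + q) h = c *: opoly b p h + opoly b q h.
Proof.
pose n := maxn (size (c *: p + q)) (maxn (size p) (size q)).
rewrite !(@opoly_wide n) ?leq_max ?leqnn ?orbT // scaler_sumr -big_split /=.
by apply: eq_bigr => i _; rewrite coefD coefZ scalerDl scalerA.
Qed.

Lemma opolyD b p q h : opoly b (p + q) h = opoly b p h + opoly b q h.
Proof. by have := opoly_linear b 1 p q h; rewrite !scale1r. Qed.

Lemma opoly0 b h : opoly b 0 h = 0.
Proof. by rewrite /opoly size_poly0 big_ord0. Qed.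

Lemma opolyZ b c p h : opoly b (c *: p) h = c *: opoly b p h.
Proof. by have := opoly_linear b c p 0 h; rewrite opoly0 !addr0. Qed.

Lemma opolyB b p q h : opoly b (p - q) h = opoly b p h - opoly b q h.
Proof. by rewrite opolyD -scaleN1r opolyZ scaleN1r. Qed.

Lemma opolyC b c h : opoly b c%:P h = c *: h.
Proof.
by rewrite (@opoly_wide 1) ?size_polyC_leq1 // big_ord1 coefC.
Qed.

Lemma opolyMX b p h : linear b -> opoly b (p * 'X) h = b (opoly b p h).
Proof.
move=> lb; rewrite (@opoly_wide (size p).+1); last first.
  by have [->|p0] := eqVneq p 0; rewrite ?mul0r ?size_poly0 // size_mulX.
rewrite big_ord_recl coefMX scale0r add0r /opoly lop_sum //.
by apply: eq_bigr => i _; rewrite coefMX /= lopZ.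
Qed.

Lemma opolyX b h : linear b -> opoly b 'X h = b h.
Proof. by move=> lb; rewrite -['X]mul1r opolyMX // opolyC scale1r. Qed.

Lemma opolyM b p q h : linear b -> opoly b (p * q) h = opoly b p (opoly b q h).
Proof.
move=> lb; elim/poly_ind: p => [|p c IH]; first by rewrite mul0r !opoly0.
rewrite mulrDl -mulrA (mulrC 'X) mulrA mul_polyC !opolyD opolyZ !opolyMX //.
by rewrite opolyC IH.
Qed.

Lemma opoly_MXaddC b p c : linear b ->
  opoly b (p * 'X + c%:P) = c *: idfun + (b \o opoly b p).
Proof.
move=> lb; apply/funext => h; rewrite opolyD (opolyMX _ _ lb) opolyC.
exact: (addrC (b (opoly b p h))).
Qed.

Lemma opoly_comm b p h : linear b -> opoly b p (b h) = b (opoly b p h).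
Proof.
by move=> lb; rewrite -{1}(opolyX h lb) -opolyM // opolyMX.
Qed.

Lemma adjoint_opoly b p : linear b -> adjoint_of ip b b ->
  adjoint_of ip (opoly b p) (opoly b (map_poly Num.conj p)).
Proof.
move=> lb ab; elim/poly_ind: p => [|p c IH] x y.
  by rewrite map_poly0 !opoly0 linear0l linear0r.
rewrite rmorphD rmorphM /= map_polyX map_polyC /= !opolyD !opolyMX // !opolyC.
rewrite linearDl linearDr linearZl_LR linearZr_LR /= conjCK ab IH.
by rewrite opoly_comm.
Qed.

End OperatorPolynomials.

(** * Support projections of algebraic self-adjoint elements *)

Section VonNeumannAlgebras.
Context {R : realType} {H : completeNormedModType R[i]}.
Variable ip : {dot H for Num.conj}.
Variable M : set (H -> H).
Hypothesis hs : hilbert_space ip.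
Hypothesis vnM : von_neumann_algebra ip M.
Implicit Types (S T a b : H -> H) (x y h : H) (c : R[i]) (f : {poly R[i]}).

Lemma M_lin T : M T -> linear T.
Proof. by move=> /(vna_bounded vnM) []. Qed.
#[local] Hint Resolve M_lin : core.

Lemma M_bnd T : M T -> bnd ip T.
Proof. by move=> /(vna_bounded vnM) /(bounded_operatorP _ hs) []. Qed.

Lemma M_id : M idfun. Proof. exact: vna_one vnM. Qed.

Lemma M_comp S T : M S -> M T -> M (S \o T).
Proof. exact: (vna_comp vnM). Qed.

Lemma M_lincomb c S T : M S -> M T -> M (c *: S + T).
Proof. exact: (vna_linear vnM). Qed.

Lemma M_0 : M 0.
Proof.
have := M_lincomb (-1) M_id M_id; congr M; apply/funext => x /=.
by rewrite /GRing.add /= scaleN1r addNr.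
Qed.

Lemma M_Z c T : M T -> M (c *: T).
Proof.
by move=> MT; rewrite -[_ *: _]addr0; apply: M_lincomb => //; exact: M_0.
Qed.

Lemma M_D S T : M S -> M T -> M (S + T).
Proof. by move=> MS MT; rewrite -[S]scale1r; exact: M_lincomb. Qed.

Lemma M_B S T : M S -> M T -> M (S - T).
Proof. by move=> MS MT; rewrite addrC -scaleN1r; exact: M_lincomb. Qed.

Lemma M_sum I (r : seq I) (F : I -> H -> H) :
  (forall i, M (F i)) -> M (\sum_(i <- r) F i).
Proof.
by move=> MF; elim/big_rec: _ => [|i S _ MS]; [exact: M_0 | exact: M_D].
Qed.

Lemma M_opoly b f : M b -> M (opoly b f).
Proof.
move=> Mb; elim/poly_ind: f => [|p c IH].
  have -> : opoly b 0 = 0 by apply/funext => h; rewrite opoly0.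
  exact: M_0.
rewrite opoly_MXaddC; last exact: M_lin.
by apply: M_lincomb; [exact: M_id | exact: M_comp].
Qed.

Definition projection p :=
  [/\ M p, adjoint_of ip p p & forall h, p (p h) = p h].

(** Put q = s a.  Taking adjoints in q a = a gives a q^* = a, hence
    q q^* = s a q^* = q, and q is self-adjoint and idempotent. *)
Lemma support_projection a s : M a -> adjoint_of ip a a -> M s ->
    (forall h, a h = s (a (a h))) ->
  [/\ projection (s \o a), forall h, s (a (a h)) = a h &
      forall h, a (s (a h)) = a h].
Proof.
move=> Ma aa Ms asa; pose q := s \o a.
have Mq : M q by exact: M_comp.
have [q' Mq' qq'] := vna_adjoint vnM Mq.
have aq' h : a (q' h) = a h.
  by apply: (@ip_inj _ _ ip) => z; rewrite -[LHS]aa -qq' /q /= -asa aa.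
have qE : q = q \o q' by apply/funext => h; rewrite /q /= aq'.
have saq : adjoint_of ip q q.
  by rewrite {1 2}qE; apply: adjoint_comp => //; exact: adjoint_sym.
have q'q := adjoint_unique qq' saq; rewrite {q'}q'q in qE aq' qq' Mq'.
by split=> //; split=> // h; rewrite -[RHS]/(q h) qE.
Qed.

(** If f(0) is nonzero, the relation f(b) b = 0 can be solved for b.  Otherwise
    f = f1 X and b^2 f1(b) = 0, so b f1(b) = 0 because b is self-adjoint, and f1
    has smaller degree.  The factor b in the hypothesis makes this induction
    close. *)
Lemma algebraic_regular b f : M b -> adjoint_of ip b b -> f != 0 ->
  (forall h, opoly b f (b h) = 0) ->
  exists2 s, M s & forall h, b h = s (b (b h)).
Proof.
move=> Mb ab; have lb := M_lin Mb.
elim/poly_ind: f => [|f c IH]; first by rewrite eqxx.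
have [->|c0] := eqVneq c 0.
  rewrite addr0 mulf_eq0 polyX_eq0 orbF => f0 fb; apply: IH => // h.
  rewrite (opoly_comm f h lb); apply: selfadjoint_cancel ab _.
  by rewrite -(opoly_comm f h lb) -(opolyMX f (b h) lb) fb.
move=> _ fb; exists (- c^-1 *: opoly b f).
  by apply: M_Z; exact: M_opoly.
move=> h; have /eqP := fb h; rewrite opolyD opolyC opolyMX // addr_eq0 => /eqP e.
rewrite -[RHS]/(- c^-1 *: opoly b f (b (b h))) opoly_comm // scaleNr -scalerN.
rewrite (_ : - _ = c *: b h) ?scalerA ?mulVf ?scale1r //.
by rewrite e opprK.
Qed.

End VonNeumannAlgebras.

(** * The seminorm of a positive operator *)

Section Seminorm.
Context {R : realType} {H : completeNormedModType R[i]}.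
Variable ip : {dot H for Num.conj}.
Variable M : set (H -> H).
Variable A : H -> H.
Hypothesis hs : hilbert_space ip.
Hypothesis vnM : von_neumann_algebra ip M.
Hypothesis MA : M A.
Hypothesis A_neq0 : A <> 0.
Hypothesis posA : positive_operator ip A.
Implicit Types (S T a b : H -> H) (x y h : H) (c : R[i]) (f : {poly R[i]}).
#[local] Notation qfA := (qf ip A).
#[local] Notation sqn := (sqn ip).

Let lA : linear A := M_lin vnM MA.

Lemma qfAE h : ip (A h) h = (qfA h)%:C.
Proof. exact/ge0_ReE/posA. Qed.

Lemma qfA_ge0 h : 0 <= qfA h.
Proof. by rewrite -ler0c -qfAE; exact: posA. Qed.

(** Polarization: <A z, z> is real for z = x + y and for z = x + i y. *)
Lemma positive_selfadjoint : adjoint_of ip A A.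
Proof.
move=> x y; rewrite (ipC ip (A y) x).
have ImE z : complex.Im (ip (A z) z) = 0 by rewrite qfAE.
have := ImE (x + 'i%C *: y); have := ImE (x + y).
rewrite !lopD // lopZ // !linearDl !linearDr /= !linearZl_LR !linearZr_LR /=.
have -> : 'i%C^*%R = - 'i%C :> R[i] by rewrite -[LHS]/(conjc 'i%C); simpc.
rewrite !qfAE; case: (ip (A x) y) (ip (A y) x) => u1 u2 [v1 v2].
rewrite -[_^*%R]/(conjc _) /=; simpc => /= e1 e2.
by congr (_ +i* _); lra.
Qed.
Let aA := positive_selfadjoint.

(** The form qf A is bounded by K sqn; the inequality is then
    0 <= qf A (h - K^-1 A h) <= qf A h - K^-1 sqn (A h).  In particular the
    seminorm vanishes only on the kernel of A. *)
Lemma sqn_le_qfA : exists2 K : R, 0 < K & forall h, sqn (A h) <= K * qfA h.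
Proof.
have [C C0 bA] := M_bnd hs vnM MA.
pose K : R := (C + 1) / 2; have K0 : 0 < K by rewrite divr_gt0 // ltr_wpDl.
exists K => // h.
have qfK z : qfA z <= K * sqn z.
  have := sqn_ge0 ip (A z - z); rewrite -scaleN1r sqnD sqnZ abs2N1 scaleN1r.
  rewrite linearNr raddfN /= -/(qfA z) => le1; have := bA z; rewrite /K; lra.
have := qfA_ge0 (h + (- K^-1)%:C *: A h).
rewrite qfD // qfZ // abs2_real linearZr_LR /= conj_real Re_mulR.
rewrite -[complex.Re _]/(sqn (A h)) => le1.
have le2 := qfK (A h).
have le3 : (- K^-1) ^+ 2 * qfA (A h) <= K^-1 * sqn (A h).
  rewrite sqrrN expr2 -mulrA ler_pM2l ?invr_gt0 //.
  by rewrite ler_pdivrMl.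
have le4 : K^-1 * sqn (A h) <= qfA h by lra.
by rewrite -ler_pdivrMl.
Qed.

Lemma qfA_eq0 h : qfA h = 0 -> A h = 0.
Proof.
move=> h0; have [K _ /(_ h)] := sqn_le_qfA; rewrite h0 mulr0 => le1.
by apply: (@sqn_eq0 _ _ ip); apply/eqP; rewrite eq_le le1 sqn_ge0.
Qed.

(** The operator seminorm is a supremum over the unit sphere of the seminorm;
    this form is homogeneous and also covers vectors of zero seminorm. *)
Lemma AboundedP T : Abounded ip M A T <->
  M T /\ exists2 C : R, 0 <= C & forall h, qfA (T h) <= C * qfA h.
Proof.
split=> [[MT bT]|[MT [C C0 bT]]]; (split; first exact: MT); last first.
  apply: (@le_lt_trans _ _ (Num.sqrt C)%:E); last exact: ltry.
  apply: ge_ereal_sup => _ [h /= h1 <-]; rewrite lee_fin ler_wsqrtr //.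
  apply: (le_trans (bT h)); rewrite -[X in _ <= X]mulr1 ler_wpM2l //.
  by rewrite -(sqr_sqrtr (qfA_ge0 h)) -/(Anorm ip A h) h1 expr1n.
have lT := M_lin vnM MT.
have [h0 Ah0] : exists h, 0 < qfA h.
  apply: contrapT => /forallNP nA; apply: A_neq0; apply/funext => h.
  by apply: qfA_eq0; apply/eqP; rewrite eq_le qfA_ge0 leNgt andbT; exact/negP.
pose normalize h := (Num.sqrt (qfA h))^-1%:C *: h.
have qfn h : 0 < qfA h -> qfA (normalize h) = 1.
  move=> h1; rewrite qfZ // abs2_real exprVn sqr_sqrtr ?(ltW h1) // mulVf //.
  by rewrite gt_eqF.
have [C C0 bC] : exists2 C : R, 0 <= C & forall h, qfA h = 1 -> qfA (T h) <= C.
  have [r br] : exists r : R, forall h, qfA h = 1 -> Num.sqrt (qfA (T h)) <= r.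
    move: bT; rewrite /Aopnorm; set E := [set _ | h in _] => bT.
    have ubE h : qfA h = 1 -> ((Num.sqrt (qfA (T h)))%:E <= ereal_sup E)%E.
      move=> h1; apply: ereal_sup_ubound; exists h => //=.
      by rewrite /Anorm -/(qfA h) h1 sqrtr1.
    move: bT ubE; case: (ereal_sup E) => [r _ ubE| //|_ ubE].
      by exists r => h /ubE; rewrite lee_fin.
    by exists 0 => h /ubE.
  exists (r ^+ 2) => [|h /br le1]; first exact: sqr_ge0.
  rewrite -(sqr_sqrtr (qfA_ge0 (T h))) ler_pXn2r ?nnegrE ?sqrtr_ge0 //.
  exact: le_trans le1.
exists C => // h; have := qfA_ge0 h.
rewrite le_eqVlt => /orP[/eqP/esym hz|h1]; last first.
  rewrite -ler_pdivrMr // mulrC.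
  have := bC _ (qfn _ h1); rewrite lopZ // qfZ // abs2_real exprVn.
  by rewrite sqr_sqrtr ?(ltW h1).
(* A vector h of zero seminorm can be added to a unit vector with any weight t
   without leaving the unit sphere, so T h must have zero seminorm. *)
rewrite hz mulr0 leNgt; apply/negP => Th.
have [g g1] : exists g, qfA g = 1 by exists (normalize h0); exact: qfn.
have le1 (t : R) : t ^+ 2 * qfA (T h) <= 4 * C.
  have gt1 : qfA (g + t%:C *: h) = 1.
    rewrite addrC qfD // qfZ // hz mulr0 add0r (lopZ _ _ lA) qfA_eq0 // scaler0.
    by rewrite linear0l mulr0 addr0 g1.
  have := qfD_le (T (g + t%:C *: h)) (- T g) lA aA qfA_ge0.
  rewrite (lopD _ _ lT) (lopZ _ _ lT) [T g + _]addrC addrK qfZ // abs2_real.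
  rewrite -[- T g]scaleN1r qfZ // abs2N1 mul1r.
  have := bC _ gt1; rewrite (lopD _ _ lT) (lopZ _ _ lT) [T g + _]addrC.
  have := bC _ g1; lra.
(* The summand 1 makes t >= 1, so that t <= t^2. *)
pose t : R := (4 * C + 1) / qfA (T h) + 1.
have := le1 t.
have t1 : 1 <= t by rewrite /t lerDr divr_ge0 ?ltW // ltr_wpDl ?mulr_ge0.
have t2 : t * qfA (T h) = 4 * C + 1 + qfA (T h).
  by rewrite /t mulrDl mul1r divfK ?gt_eqF.
have : t * qfA (T h) <= t ^+ 2 * qfA (T h).
  by rewrite ler_wpM2r ?(ltW Th) // expr2 ler_peMl // (le_trans _ t1).
rewrite t2; lra.
Qed.

(** The seminorm of C (A h) is bounded by the norm of A h, which is itself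
    bounded by the seminorm of h. *)
Lemma Abounded_compA C : M C -> Abounded ip M A (C \o A).
Proof.
move=> MC; apply/AboundedP; split; first exact: (M_comp vnM).
have [K K0 bK] := sqn_le_qfA.
have [L L0 bL] := M_bnd hs vnM (M_comp vnM MA MC).
have [L' L'0 bL'] := M_bnd hs vnM MC.
exists ((L + L') * K) => [|h]; first by rewrite mulr_ge0 ?addr_ge0 // ltW.
have le1 : qfA (C (A h)) <= (L + L') * sqn (A h).
  have := sqn_ge0 ip (A (C (A h)) - C (A h)).
  rewrite -scaleN1r sqnD sqnZ abs2N1 scaleN1r linearNr raddfN /=.
  rewrite -/(qfA (C (A h))).
  have := bL (A h); have := bL' (A h) => /=.
  have := sqn_ge0 ip (A h); nra.
apply: (le_trans le1); rewrite -mulrA ler_wpM2l ?addr_ge0 //.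
Qed.

Lemma Abounded_lincomb c S T : Abounded ip M A S -> Abounded ip M A T ->
  Abounded ip M A (c *: S + T).
Proof.
move=> /AboundedP[MS [C C0 bS]] /AboundedP[MT [D D0 bT]]; apply/AboundedP.
split; first exact: (M_lincomb vnM).
exists (2 * (abs2 c * C) + 2 * D) => [|h].
  by rewrite addr_ge0 ?mulr_ge0 ?abs2_ge0.
apply: (le_trans (qfD_le _ _ lA aA qfA_ge0)); rewrite qfZ; last exact: lA.
have := bT h; have := ler_wpM2l (abs2_ge0 c) (bS h); lra.
Qed.

Lemma Abounded_comp S T : Abounded ip M A S -> Abounded ip M A T ->
  Abounded ip M A (S \o T).
Proof.
move=> /AboundedP[MS [C C0 bS]] /AboundedP[MT [D D0 bT]]; apply/AboundedP.
split; first exact: (M_comp vnM).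
exists (C * D) => [|h]; first exact: mulr_ge0.
by apply: (le_trans (bS _)); rewrite -mulrA ler_wpM2l.
Qed.

Lemma Abounded_id : Abounded ip M A idfun.
Proof.
apply/AboundedP; split; first exact: (M_id vnM).
by exists 1 => // h; rewrite mul1r.
Qed.

Lemma Abounded_0 : Abounded ip M A 0.
Proof.
apply/AboundedP; split; first exact: (M_0 vnM).
by exists 0 => // h; rewrite mul0r /qf linear0r.
Qed.

Lemma Abounded_Z c T : Abounded ip M A T -> Abounded ip M A (c *: T).
Proof.
move=> bT; rewrite -[_ *: _]addr0.
by apply: Abounded_lincomb => //; exact: Abounded_0.
Qed.

Lemma Abounded_opoly T f : Abounded ip M A T -> Abounded ip M A (opoly T f).
Proof.
move=> bT; have /AboundedP[MT _] := bT; have lT := M_lin vnM MT.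
elim/poly_ind: f => [|f c IH].
  have -> : opoly T 0 = 0 by apply/funext => h; rewrite opoly0.
  exact: Abounded_0.
rewrite (opoly_MXaddC _ _ lT).
by apply: Abounded_lincomb; [exact: Abounded_id | exact: Abounded_comp].
Qed.

Lemma Abounded_kernel T h : Abounded ip M A T -> A h = 0 -> A (T h) = 0.
Proof.
move=> /AboundedP[_ [C _ bT]] Ah; apply: qfA_eq0; apply/eqP.
rewrite eq_le qfA_ge0 andbT; have := bT h.
by rewrite {2}/qf Ah linear0l mulr0.
Qed.

(** If f(z) is nonzero, write f = u (X - z) + f(z).  Then A f(T) = 0 says that
    A u(T) (z - T) = f(z) A, so u(T) / f(z) is an A-inverse of z - T. *)
Lemma Aspectrum_sub_roots T f : Abounded ip M A T ->
  (forall h, A (opoly T f h) = 0) -> Aspectrum ip M A T `<=` [set z | root f z].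
Proof.
move=> bT Af z; apply: contra_notP => /= /negP nz.
have /AboundedP[MT _] := bT; have lT := M_lin vnM MT.
have : root (f - f.[z]%:P) z by rewrite rootE !hornerE subrr.
move=> /factor_theorem[u uE].
have fE : f = u * ('X - z%:P) + f.[z]%:P by rewrite -uE subrK.
have lu : linear (opoly T u) by exact/(M_lin vnM)/(M_opoly vnM).
have Tz h : opoly T ('X - z%:P) h = - (z *: h - T h).
  by rewrite opolyB opolyX // opolyC opprB.
have key h : A (opoly T u (z *: h - T h)) = f.[z] *: A h.
  have := Af h; rewrite {1}fE opolyD opolyM // Tz opolyC.
  rewrite (lopD _ _ lA) (lopZ _ _ lA) (lopN _ lu) (lopN _ lA).
  by move/eqP; rewrite addrC subr_eq0 => /eqP.
exists ((f.[z])^-1 *: opoly T u).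
  by apply: Abounded_Z; exact: Abounded_opoly.
have comm h : z *: opoly T u h - T (opoly T u h) = opoly T u (z *: h - T h).
  by rewrite -opoly_comm // lopB // lopZ.
split; apply/funext => h.
  pose w := (f.[z])^-1 *: opoly T u h.
  rewrite /= -[X in A X]/(z *: w - T w) /w.
  rewrite (lopZ _ _ lT) scalerA mulrC -scalerA -scalerBr comm (lopZ _ _ lA) key.
  by rewrite scalerA mulVf // scale1r.
rewrite /= -[X in A X]/((f.[z])^-1 *: opoly T u (z *: h - T h)).
by rewrite (lopZ _ _ lA) key scalerA mulVf // scale1r.
Qed.

End Seminorm.

(** * Minimal left ideals and minimal projections *)

Section MinimalLeftIdeals.
Context {R : realType} {H : completeNormedModType R[i]}.
Variable ip : {dot H for Num.conj}.
Variable M : set (H -> H).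
Hypothesis hs : hilbert_space ip.
Hypothesis vnM : von_neumann_algebra ip M.
Implicit Types (S T a b d p q x y : H -> H) (h : H) (c : R[i]) (J : set (H -> H)).

Let M_lin := M_lin vnM.

Lemma adjoint_square_eq0 x x' : adjoint_of ip x x' -> x' \o x = 0 -> x = 0.
Proof.
move=> ax xx; apply/funext => h; apply/eqP; rewrite -(dnorm_eq0 ip) ax.
by rewrite -[x' (x h)]/((x' \o x) h) xx linear0r.
Qed.

Definition principal a : set (H -> H) := [set X | exists2 S, M S & X = S \o a].

Lemma principal_left_ideal a : M a -> left_ideal M (principal a).
Proof.
move=> Ma; split.
- by move=> _ [S MS ->]; exact: (M_comp vnM).
- by exists 0; first exact: (M_0 vnM).
- move=> c _ _ [S MS ->] [T MT ->]; exists (c *: S + T) => //.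
  exact: (M_lincomb vnM).
- by move=> S _ MS [T MT ->]; exists (S \o T) => //; exact: (M_comp vnM).
Qed.

Lemma principal_self a : principal a a.
Proof. by exists idfun; first exact: (M_id vnM). Qed.

Lemma principal_sub J a : left_ideal M J -> J a -> principal a `<=` J.
Proof. by move=> lJ Ja _ [S MS ->]; exact: (lideal_comp lJ). Qed.

(** This is the division property behind Schur's lemma. *)
Lemma minimal_divides J d x : minimal_left_ideal M J -> J d -> d <> 0 -> J x ->
  exists2 t, M t & x = t \o d.
Proof.
move=> [lJ _ minJ] Jd d0 Jx.
have [E|E] := minJ _ (principal_left_ideal (lideal_sub lJ Jd)) (principal_sub lJ Jd).
  by case: d0; have := principal_self d; rewrite E.
by move: Jx; rewrite -E.
Qed.

(** Take a = x^* x for a nonzero x in J. *)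
Lemma left_ideal_square J : left_ideal M J -> J <> [set 0] ->
  exists a, [/\ J a, adjoint_of ip a a & a <> 0].
Proof.
move=> lJ J0; have [x [Jx x0]] : exists x, J x /\ x <> 0.
  apply: contrapT => /forallNP nJ; apply: J0; apply/seteqP; split=> [x Jx|_ ->].
    by have /not_andP[//|/contrapT] := nJ x.
  exact: (lideal0 lJ).
have [x' Mx' ax] := vna_adjoint vnM (lideal_sub lJ Jx).
exists (x' \o x); split; first exact: (lideal_comp lJ).
  by apply: adjoint_comp => //; exact: adjoint_sym.
by move/(adjoint_square_eq0 ax).
Qed.

(** With a as in [left_ideal_square], minimality gives J = M a^2, so a = s a^2
    and the support projection of a generates J. *)
Lemma minimal_ideal_projection J : minimal_left_ideal M J ->
  exists q, [/\ projection ip M q, J q & forall x h, J x -> x (q h) = x h].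
Proof.
move=> mJ; have [lJ J0 _] := mJ; have [a [Ja aa a0]] := left_ideal_square lJ J0.
have Ma := lideal_sub lJ Ja.
have aa0 : a \o a <> 0.
  by move=> aaE; apply: a0; apply: adjoint_square_eq0 aa _.
have [s Ms asE] := minimal_divides mJ (lideal_comp lJ Ma Ja) aa0 Ja.
have asa h : a h = s (a (a h)) by rewrite {1}asE.
have [pq _ aq] := support_projection vnM Ma aa Ms asa.
exists (s \o a); split=> // [|x h Jx]; first exact: (lideal_comp lJ).
by have [t _ ->] := minimal_divides mJ Ja a0 Jx; rewrite /= aq.
Qed.

(** Let N be the square of the norm of b.  If b^2 - N q were nonzero, it would
    have a left inverse relative to q, which [norm_square_spectral] forbids.
    So (b - s q) (b + s q) = 0 with s^2 = N, and if the first factor is nonzero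
    it can be cancelled on the left. *)
Lemma minimal_corner_selfadjoint J q b : minimal_left_ideal M J ->
    projection ip M q -> J q -> M b -> adjoint_of ip b b ->
    (forall h, b (q h) = b h) -> (forall h, q (b h) = b h) ->
  exists c, forall h, b h = c *: q h.
Proof.
move=> mJ [Mq _ qq] Jq Mb ab bq qb; have [lJ _ _] := mJ.
have Jb : J b.
  by have := lideal_comp lJ Mb Jq; congr J; apply/funext => h; exact: bq.
have [->|b0] := pselect (b = 0); first by exists 0 => h; rewrite scale0r.
have [N N0 specN] := norm_square_spectral (M_lin Mb) ab (M_bnd hs vnM Mb) b0.
have lq := M_lin Mq.
have Jlin c x y : J x -> J y -> J (x + c *: y).
  by move=> Jx Jy; rewrite addrC; exact: (lideal_linear lJ).
have [b2|b2] := pselect (b \o b + (- N%:C) *: q = 0); last first.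
  have Jb2 : J (b \o b + (- N%:C) *: q).
    by apply: Jlin => //; exact: (lideal_comp lJ).
  have [t Mt qt] := minimal_divides mJ Jb2 b2 Jq.
  case: (specN (b \o (t \o q))) => [|h].
    by apply: (M_bnd hs vnM); do 2 apply: (M_comp vnM) => //.
  rewrite /= (lopB _ _ lq) (lopZ _ _ lq) qb -[in LHS]bq {1}qt /=.
  congr (b (t _)); rewrite -[LHS]/(b (b h) + - N%:C *: q h).
  by rewrite scaleNr.
pose s := (Num.sqrt N)%:C : R[i].
have sE : s * s = N%:C by rewrite -rmorphM -expr2 sqr_sqrtr // ltW.
have [u0|u0] := pselect (b + (- s) *: q = 0).
  exists s => h; have /eqP : (b + - s *: q) h = 0 by rewrite u0.
  by rewrite -[X in X == 0]/(b h + - s *: q h) scaleNr subr_eq0 => /eqP.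
have [t Mt qt] := minimal_divides mJ (Jlin (- s) _ _ Jb Jq) u0 Jq.
exists (- s) => h; apply/eqP; rewrite -subr_eq0 scaleNr opprK; apply/eqP.
have -> : b h + s *: q h = q (b h + s *: q h).
  by rewrite (lopD _ _ lq) (lopZ _ _ lq) qb qq.
rewrite {1}qt /= -[X in t X]/(b (b h + s *: q h) + - s *: q (b h + s *: q h)).
have lb := M_lin Mb.
rewrite (lopD _ _ lb) (lopZ _ _ lb) (lopD _ _ lq) (lopZ _ _ lq) bq qb qq.
rewrite scalerDr !scaleNr scalerA sE addrA addrK.
have -> : b (b h) - N%:C *: q h = 0.
  have : (b \o b + - N%:C *: q) h = 0 by rewrite b2.
  by rewrite -[LHS]/(b (b h) + - N%:C *: q h) scaleNr.
exact: (lop0 (M_lin Mt)).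
Qed.

(** A projection q with q M q = C q. *)
Definition minimal_projection q := projection ip M q /\
  forall y, M y -> exists c, forall h, q (y (q h)) = c *: q h.

(** Split q y q into real and imaginary parts. *)
Lemma minimal_ideal_minimal_projection J q : minimal_left_ideal M J ->
  projection ip M q -> J q -> minimal_projection q.
Proof.
move=> mJ pq Jq; split=> // y My; have [Mq aq qq] := pq; have lq := M_lin Mq.
have [y' My' ay] := vna_adjoint vnM My.
pose z := q \o (y \o q); pose z' := q \o (y' \o q).
have Mz : M z by do 2 apply: (M_comp vnM) => //.
have Mz' : M z' by do 2 apply: (M_comp vnM) => //.
have az : adjoint_of ip z z'.
  by move=> h k; rewrite /z /z' /= aq ay aq.
have az' : adjoint_of ip z' z by exact: adjoint_sym.
have qz h : q (z h) = z h by rewrite /z /= qq.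
have qz' h : q (z' h) = z' h by rewrite /z' /= qq.
have zq h : z (q h) = z h by rewrite /z /= qq.
have zq' h : z' (q h) = z' h by rewrite /z' /= qq.
have [||h|h|c1 E1] := @minimal_corner_selfadjoint J q (z + z') mJ pq Jq.
- exact: (M_D vnM).
- by rewrite {2}addrC; exact: adjointD.
- by rewrite -[LHS]/(z (q h) + z' (q h)) zq zq'.
- by rewrite -[X in q X]/(z h + z' h) (lopD _ _ lq) qz qz'.
have [||h|h|c2 E2] := @minimal_corner_selfadjoint J q ('i%C *: (z - z')) mJ pq Jq.
- by apply: (M_Z vnM); exact: (M_B vnM).
- have E : 'i%C *: (z - z') = 'i%C^*%R *: (z' - z).
    rewrite -opprB scalerN -scaleNr; congr (_ *: _).
    by rewrite -[in RHS]/(conjc 'i%C); simpc.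
  by rewrite {2}E; apply: adjointZ; exact: adjointB.
- by rewrite -[LHS]/('i%C *: (z (q h) - z' (q h))) zq zq'.
- by rewrite -[X in q X]/('i%C *: (z h - z' h)) (lopZ _ _ lq) (lopB _ _ lq) qz qz'.
exists ((c1 - 'i%C * c2) / 2) => h.
have e1 : z h + z' h = c1 *: q h by exact: E1.
have e2 : 'i%C *: (z h - z' h) = c2 *: q h by exact: E2.
rewrite -[LHS]/(z h) mulrC -scalerA scalerBl -e1 -['i%C * c2 *: _]scalerA -e2.
rewrite ['i%C *: ('i%C *: _)]scalerA.
have -> : 'i%C * 'i%C = - 1 :> R[i] by rewrite -expr2 sqr_i.
rewrite scaleN1r opprK addrACA addrN addr0 -mulr2n -[z h *+ 2]scaler_nat scalerA.
by rewrite mulVf ?scale1r ?pnatr_eq0.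
Qed.

(** The dimension of p M q is at most one: for a nonzero x and any w in p M q,
    w x^* = c p and x^* x = d q with d nonzero, so d w = w x^* x = c x. *)
Lemma minimal_projection_corner p q :
  minimal_projection p -> minimal_projection q ->
  exists e : H -> H, forall y, M y -> exists c, forall h, p (y (q h)) = c *: e h.
Proof.
move=> [[Mp ap pp] cp] [[Mq aq qq] cq].
have [[y0 [My0 x0]]|no] :=
    pselect (exists y, M y /\ p \o (y \o q) <> 0); last first.
  exists 0 => y My; exists 0 => h; rewrite scale0r.
  have /forallNP/(_ y)/not_andP[//|/contrapT E] := no.
  by rewrite -[LHS]/((p \o (y \o q)) h) E.
pose x := p \o (y0 \o q).
have [y0' My0' ay0] := vna_adjoint vnM My0.
have ax : adjoint_of ip x (q \o (y0' \o p)).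
  by move=> h k; rewrite /x /= ap ay0 aq.
have [d dE] := cq _ (M_comp vnM My0' (M_comp vnM Mp My0)).
have d0 : d != 0.
  apply/eqP => d0; apply: x0; apply: adjoint_square_eq0 ax _; apply/funext => h.
  by rewrite /x /= pp dE d0 scale0r.
exists x => y My.
have [c cE] := cp _ (M_comp vnM My (M_comp vnM Mq My0')).
exists (d^-1 * c) => h; apply: (can_inj (scalerK d0)).
rewrite scalerA mulrA divff // mul1r.
have := cE (y0 (q h)); rewrite /= => <-.
have := dE h => /= dEh.
have lin T : M T -> linear T by exact: M_lin.
rewrite -(lopZ _ _ (lin _ Mp)) -(lopZ _ _ (lin _ My)) -dEh.
by [].
Qed.

End MinimalLeftIdeals.

(** * Spectra relative to an element of the socle *)

Section SocleFiniteSpectrum.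
Context {R : realType} {H : completeNormedModType R[i]}.
Variable ip : {dot H for Num.conj}.
Variable M : set (H -> H).
Hypothesis hs : hilbert_space ip.
Hypothesis vnM : von_neumann_algebra ip M.
Implicit Types (S T A : H -> H) (h : H) (c : R[i]) (f : {poly R[i]}).

Let M_lin := M_lin vnM.

(** The coefficients of f are the entries of a row vector in the kernel of the
    (#|I| + 1) x #|I| matrix of coordinates of the first #|I| + 1 vectors. *)
Lemma finite_span_dependent (I : finType) (e : I -> H -> H) (v : nat -> H -> H) :
  (forall k, exists c : I -> R[i], forall h, v k h = \sum_i c i *: e i h) ->
  exists2 f : {poly R[i]}, f != 0 &
    forall h, \sum_(k < size f) f`_k *: v k h = 0.
Proof.
move=> /choice[c vE]; pose n := #|I|.
pose B : 'M[R[i]]_(n.+1, n) := \matrix_(k, j) c k (enum_val j).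
have : kermx B != 0.
  rewrite -mxrank_eq0 mxrank_ker subn_eq0 -ltnNge ltnS; exact: rank_leq_col.
move=> /rowV0Pn[u /sub_kermxP uB u0].
exists (rVpoly u) => [|h].
  by apply: contra u0 => /eqP u0; rewrite -[u]rVpolyK u0 linear0.
have fu : (size (rVpoly u) <= n.+1)%N by exact: size_poly.
have -> : \sum_(k < size (rVpoly u)) (rVpoly u)`_k *: v k h =
    \sum_(k < n.+1) (rVpoly u)`_k *: v k h.
  rewrite (big_ord_widen _ (fun k => (rVpoly u)`_k *: v k h) fu) big_mkcond /=.
  apply: eq_bigr => k _; case: ltnP => // /(nth_default 0) ->.
  by rewrite scale0r.
under eq_bigr => k _ do rewrite coef_rVpoly_ord vE scaler_sumr.
rewrite exchange_big /= big1 // => i _.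
under eq_bigr => k _ do rewrite scalerA.
rewrite -scaler_suml.
have -> : \sum_(k < n.+1) u 0 k * c k i = (u *m B) 0 (enum_rank i).
  by rewrite mxE; apply: eq_bigr => k _; rewrite mxE enum_rankK.
by rewrite uB mxE scale0r.
Qed.

(** With A = sum_j X_j q_j and A = A^* = sum_i q_i X_i^*, the operator A S A
    is the sum of the q_i (X_i^* S X_j) q_j, each in a space of dimension at
    most one. *)
Lemma socle_sandwich A : M A -> adjoint_of ip A A -> socle M A ->
  exists (I : finType) (e : I -> H -> H), forall S, M S ->
    exists c : I -> R[i], forall h, A (S (A h)) = \sum_i c i *: e i h.
Proof.
move=> MA aA [n [X [mX AE]]].
have /choice[q qP] : forall i, exists q, minimal_projection ip M q /\
    forall h, X i (q h) = X i h.
  move=> i; have [J mJ JX] := mX i.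
  have [q [pq Jq Jr]] := minimal_ideal_projection vnM mJ.
  exists q; split=> [|h]; last exact: Jr.
  exact: (minimal_ideal_minimal_projection hs vnM mJ).
have MX i : M (X i) by have [J [lJ _ _] JX] := mX i; exact: (lideal_sub lJ).
have /choice[Y YP] : forall i, exists Y, M Y /\ adjoint_of ip (X i) Y.
  by move=> i; have [Y MY aY] := vna_adjoint vnM (MX i); exists Y.
have qY i h : q i (Y i h) = Y i h.
  have [[[_ aq _] _] Xq] := qP i.
  apply: (@ip_inj _ _ ip) => z; rewrite -aq -(YP i).2 Xq.
  by rewrite (YP i).2.
have AY h : A h = \sum_(i < n) Y i h.
  rewrite -sum_opE; congr (_ h); apply: adjoint_unique aA _.
  rewrite AE; apply: adjoint_sum => i; exact: (YP i).2.
have AX h : A h = \sum_(i < n) X i h by rewrite AE sum_opE.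
have /choice[e eP] : forall ij : 'I_n * 'I_n, exists e : H -> H,
    forall y, M y -> exists c, forall h, q ij.1 (y (q ij.2 h)) = c *: e h.
  by move=> ij; apply: (minimal_projection_corner vnM); apply: (qP _).1.
exists ('I_n * 'I_n)%type, e => S MS.
have /choice[c cP] : forall ij : 'I_n * 'I_n, exists c, forall h,
    q ij.1 (Y ij.1 (S (X ij.2 (q ij.2 h)))) = c *: e ij h.
  move=> ij; apply: (eP ij (Y ij.1 \o (S \o X ij.2))).
  by apply: (M_comp vnM); [exact: (YP _).1 | apply: (M_comp vnM)].
exists c => h.
under eq_bigr => ij _ do rewrite -cP qY (qP _).2.
rewrite -(pair_bigA _ (fun i j => Y i (S (X j h)))) /= AY.
apply: eq_bigr => i _; rewrite AX (lop_sum _ _ _ (M_lin MS)).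
by rewrite (lop_sum _ _ _ (M_lin (YP i).1)).
Qed.

(** The linear dependence is used twice: for the A^(k + 2), to get the support
    projection s A of A, and then for the A T^k = A T^k s A. *)
Lemma socle_finite_Aspectrum A T : M A -> A <> 0 -> positive_operator ip A ->
  socle M A -> Abounded ip M A T -> finite_set (Aspectrum ip M A T).
Proof.
move=> MA A0 posA sA bT; have lA := M_lin MA.
have aA := positive_selfadjoint vnM MA posA.
have [I [e eP]] := socle_sandwich MA aA sA.
have M_iter S k : M S -> M (iter k S).
  move=> MS; elim: k => [|k IH]; first exact: (M_id vnM).
  exact: (M_comp vnM MS IH).
have [g g0 gA] := finite_span_dependent (v := fun k h => A (iter k A (A h)))
  (fun k => eP _ (M_iter A k MA)).
have gAE h : opoly A (g * 'X) (A h) = 0.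
  rewrite (opolyMX _ _ lA) /opoly (lop_sum _ _ _ lA) -[RHS](gA h).
  by apply: eq_bigr => k _; rewrite (lopZ _ _ lA).
have gX0 : g * 'X != 0 by rewrite mulf_neq0 // polyX_eq0.
have [s Ms sE] := algebraic_regular vnM MA aA gX0 gAE.
have [_ sAA AsA] := support_projection vnM MA aA Ms sE.
have [MT _] := bT; have lT := M_lin MT.
have kerT k x : A x = 0 -> A (iter k T x) = 0.
  by move=> Ax; elim: k => //= k; exact: (Abounded_kernel hs vnM MA A0 posA bT).
have ATs k h : A (iter k T h) = A (iter k T (s (A h))).
  apply/eqP; rewrite -subr_eq0 -(lopB _ _ lA) -(lopB _ _ (M_lin (M_iter T k MT))).
  by rewrite kerT // (lopB _ _ lA) AsA subrr.
have [|f f0 fT] := @finite_span_dependent I e (fun k h => A (iter k T h)).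
  move=> k; have [c cE] := eP _ (M_comp vnM (M_iter T k MT) Ms).
  by exists c => h; rewrite ATs -cE.
have fTE h : A (opoly T f h) = 0.
  rewrite /opoly (lop_sum _ _ _ lA) -[RHS](fT h).
  by apply: eq_bigr => k _; rewrite (lopZ _ _ lA).
apply: (sub_finite_set (Aspectrum_sub_roots hs vnM MA A0 posA bT fTE)).
have [r fE] := closed_field_poly_normal f.
apply/finite_seqP; exists r; apply/seteqP; split=> z /=;
  by rewrite fE rootZ ?lead_coef_eq0 // root_prod_XsubC.
Qed.

End SocleFiniteSpectrum.

(** * Weighted sums of orthogonal projections *)

Section WeightedSeries.
Context {R : realType} {H : completeNormedModType R[i]}.
Variable ip : {dot H for Num.conj}.
Variable M : set (H -> H).
Hypothesis hs : hilbert_space ip.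
Hypothesis vnM : von_neumann_algebra ip M.
Implicit Types (T p q : H -> H) (h : H).

Let M_lin := M_lin vnM.

(** Any summable sequence of distinct nonzero weights would do; powers of 1/2
    have explicit tails. *)
Definition weight n : R[i] := 2^-1 ^+ n.

Lemma weight_gt0 n : 0 < weight n.
Proof. by rewrite exprn_gt0 // invr_gt0. Qed.

Lemma weight_inj : injective weight.
Proof.
move=> m n; wlog lemn : m n / (m <= n)%N => [wl|].
  by case/orP: (leq_total m n) => le mn; [|symmetry]; apply: wl.
move=> E; apply/eqP; rewrite eqn_leq lemn leqNgt; apply/negP => ltmn.
have : weight n < weight m.
  by rewrite ltr_iXn2l // ?invr_gt0 // invf_lt1 // ltr1n.
by rewrite E ltxx.
Qed.

Lemma sum_weight m n :
  \sum_(m <= k < m + n) weight k = 2 * (weight m - weight (m + n)).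
Proof.
elim: n => [|n IH]; first by rewrite addn0 big_geq // subrr mulr0.
rewrite addnS big_nat_recr ?leq_addr //= IH /weight exprS.
by field.
Qed.

Lemma weight_small (e x : R[i]) : 0 < e -> 0 <= x -> exists n, weight n * x < e.
Proof.
move=> e0 x0; rewrite (ge0_ReE x0) (ge0_ReE (ltW e0)).
set a := complex.Re x; set d := complex.Re e.
have d0 : 0 < d by move: e0; rewrite ltcE => /andP[].
have a0 : 0 <= a by move: x0; rewrite lecE => /andP[].
have [n nE] : exists n : nat, a / d < n%:R.
  by exists (Num.truncn (a / d)).+1; exact: truncnS_gt.
exists n.
have -> : weight n = (2^-1 ^+ n)%:C :> R[i].
  by rewrite rmorphXn /= fmorphV rmorph_nat.
rewrite -rmorphM ltcR exprVn mulrC ltr_pdivrMr ?exprn_gt0 //.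
rewrite ltr_pdivrMr // mulrC in nE; apply: (lt_le_trans nE).
by rewrite ler_pM2l // -natrX ler_nat ltnW // ltn_expl.
Qed.

(** Pythagoras. *)
Lemma projection_contract p h : projection ip M p -> `|p h| <= `|h|.
Proof.
move=> [_ ap pp]; rewrite -(@ler_pXn2r _ 2) ?nnegrE // !hs !sqnE lecR.
have := sqn_ge0 ip (h - p h).
rewrite -scaleN1r sqnD sqnZ abs2N1 scaleN1r linearNr raddfN /=.
have -> : complex.Re (ip h (p h)) = sqn ip (p h) by rewrite /sqn ap pp.
lra.
Qed.

Variable r : nat -> H -> H.
Hypothesis pr : forall n, projection ip M (r n).

Definition psum n h : H := \sum_(0 <= k < n) weight k *: r k h.

Lemma psum_cauchy_bound m n h :
  `|psum (m + n) h - psum m h| <= weight m * (2 * `|h|).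
Proof.
rewrite /psum (big_cat_nat _ (leq_addr n m)) //= [X in X - _]addrC addrK.
apply: (le_trans (ler_norm_sum _ _ _)).
apply: (@le_trans _ _ (\sum_(m <= k < m + n) weight k * `|h|)).
  apply: ler_sum => k _; rewrite normrZ ger0_norm ?(ltW (weight_gt0 k)) //.
  by rewrite ler_pM2l ?weight_gt0 // projection_contract.
rewrite -mulr_suml sum_weight mulrA [weight m * 2]mulrC ler_wpM2r //.
by rewrite ler_pM2l // gerBl ltW // weight_gt0.
Qed.

Lemma psum_cvg h : cvgn (psum ^~ h).
Proof.
apply/cauchy_cvgP/cauchy_ballP => e e0.
have [n ltn] : exists n, weight n * (2 * `|h|) < e / 2.
  by apply: weight_small; rewrite ?divr_gt0 ?mulr_ge0.
have near_n m : (n <= m)%N -> `|psum m h - psum n h| < e / 2.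
  by move=> /subnKC <-; apply: le_lt_trans ltn; exact: psum_cauchy_bound.
pose tail := [set psum m h | m in [set m | (n <= m)%N]].
have tailP : (psum ^~ h @ \oo) tail by exists n => // m /= nm; exists m.
exists (tail, tail); first by split.
move=> [_ _] /= [[i ni <-] [j nj <-]]; rewrite -ball_normE /=.
rewrite (splitr e) -(subrKA (psum n h)) (le_lt_trans (ler_normD _ _)) //.
by rewrite ltrD ?near_n // distrC near_n.
Qed.

Definition wseries h : H := limn (psum ^~ h).

Lemma wseriesP h : (psum ^~ h) @ \oo --> wseries h.
Proof. exact: psum_cvg. Qed.

Lemma wseries_unique h l : (psum ^~ h) @ \oo --> l -> wseries h = l.
Proof. by move=> hl; apply: norm_cvg_unique hl; exact: wseriesP. Qed.

Lemma psum_linear n : linear (psum n).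
Proof.
move=> c x y; rewrite /psum scaler_sumr -big_split /=; apply: eq_bigr => k _.
have [/M_lin lr _ _] := pr k.
by rewrite (lopD _ _ lr) (lopZ _ _ lr) scalerDr !scalerA mulrC.
Qed.

Lemma wseries_linear : linear wseries.
Proof.
move=> c x y; apply: wseries_unique.
under eq_fun do rewrite psum_linear.
by apply: cvgD; [apply: cvgZr|]; exact: wseriesP.
Qed.

Lemma wseries_bnd : bnd ip wseries.
Proof.
have nE x : `|x| ^+ 2 = (sqn ip x)%:C by rewrite hs sqnE.
exists 9 => // h; rewrite -lecR rmorphM rmorph_nat /= -!nE.
have -> : 9 * `|h| ^+ 2 = (3 * `|h|) ^+ 2 by rewrite exprMn -natrX.
rewrite ler_pXn2r ?nnegrE ?mulr_ge0 //.
(* The bound |wseries h| <= 3 |h|: the partial sums are bounded by 2 |h|, and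
   some partial sum is at distance at most |h| from the limit. *)
have [->|h0] := eqVneq h 0; first by rewrite (lop0 wseries_linear) normr0 mulr0.
have /cvgrPdist_lt/(_ `|h|) := @wseriesP h.
rewrite normr_gt0 => /(_ h0)[n _ /(_ n (leqnn n))] /= le1.
have := psum_cauchy_bound 0 n h; rewrite add0n {2}/psum big_geq // subr0.
rewrite /weight expr0 mul1r => le2.
rewrite -[wseries h](subrK (psum n h)); apply: (le_trans (ler_normD _ _)).
have -> : 3 * `|h| = `|h| + 2 * `|h| by ring.
by rewrite lerD // ltW // distrC.
Qed.

Lemma M_psum n : M (psum n).
Proof.
have -> : psum n = \sum_(0 <= k < n) weight k *: r k.
  by apply/funext => h; rewrite sum_opE.
by apply: (M_sum vnM) => k; apply: (M_Z vnM); have [] := pr k.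
Qed.

(** The partial sums converge pointwise, and M is strongly closed. *)
Lemma M_wseries : M wseries.
Proof.
apply: (vna_closed vnM); split; last first.
  by apply/(bounded_operatorP _ hs); split; [exact: wseries_linear|exact: wseries_bnd].
rewrite closureEcvg.
exists ((psum : nat -> {ptws H -> H}) @ \oo).
  exact: fmap_proper_filter.
split; first by apply/pointwise_cvgP => h; exact: wseriesP.
by move=> B MB; exists 0%N => // n _; apply: MB; exact: M_psum.
Qed.

Lemma wseries_eigen : (forall m n h, m != n -> r m (r n h) = 0) ->
  forall n h, wseries (r n h) = weight n *: r n h.
Proof.
move=> orth n h; apply: wseries_unique; apply: cvg_near_cst.
exists n.+1 => // m /= nm; rewrite /psum big_mkord (bigD1 (Ordinal nm)) //=.
have [_ _ rr] := pr n; rewrite rr big1 ?addr0 // => k kn.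
by rewrite orth ?scaler0 //; apply: contra kn => /eqP kn; apply/eqP/val_inj.
Qed.

Lemma wseries_absorb p : (forall n h, r n (p h) = r n h) ->
  forall h, wseries (p h) = wseries h.
Proof.
move=> rp h; apply: wseries_unique.
have -> : psum ^~ (p h) = psum ^~ h.
  by apply/funext => n; apply: eq_bigr => k _; rewrite rp.
exact: wseriesP.
Qed.

End WeightedSeries.

(** * Positive operators with finite relative spectra *)

Section SocleIdeal.
Context {R : realType} {H : completeNormedModType R[i]}.
Variable M : set (H -> H).
Implicit Types (S T : H -> H).

Lemma socle_0 : socle M 0.
Proof. by exists 0%N, (fun=> 0); split=> [[]//|]; rewrite big_ord0. Qed.

Lemma socle_D S T : socle M S -> socle M T -> socle M (S + T).
Proof.
move=> [m [X [mX ->]]] [n [Y [mY ->]]].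
exists (m + n)%N, (fun i : 'I_(m + n) =>
  match fintype.split i with inl j => X j | inr k => Y k end).
split=> [i|]; first by case: (fintype.split i).
rewrite big_split_ord /=; congr (_ + _); apply: eq_bigr => i _.
  by rewrite -[lshift n i]/(unsplit (inl i)) unsplitK.
by rewrite -[rshift m i]/(unsplit (inr i)) unsplitK.
Qed.

Lemma minimal_socle J T : minimal_left_ideal M J -> J T -> socle M T.
Proof.
move=> mJ JT; exists 1%N, (fun=> T); split; first by move=> _; exists J.
by rewrite big_ord1.
Qed.

Lemma socle_compl S T :
  M S -> linear S -> socle M T -> socle M (S \o T).
Proof.
move=> MS lS [n [X [mX ->]]]; exists n, (fun i => S \o X i); split=> [i|].
  have [J mJ JX] := mX i; exists J => //; have [lJ _ _] := mJ.
  exact: (lideal_comp lJ).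
by apply/funext => h; rewrite /= !sum_opE (lop_sum _ _ _ lS).
Qed.

End SocleIdeal.

Section FiniteSpectrumSocle.
Context {R : realType} {H : completeNormedModType R[i]}.
Variable ip : {dot H for Num.conj}.
Variable M : set (H -> H).
Variable A : H -> H.
Hypothesis hs : hilbert_space ip.
Hypothesis vnM : von_neumann_algebra ip M.
Hypothesis MA : M A.
Hypothesis A_neq0 : A <> 0.
Hypothesis posA : positive_operator ip A.
Hypothesis finA :
  forall T : H -> H, Abounded ip M A T -> finite_set (Aspectrum ip M A T).
Implicit Types (S T a b p q : H -> H) (h : H) (c z : R[i]).

Let M_lin := M_lin vnM.
Let lA : linear A := M_lin MA.

(** If S is an A-inverse of z - b and b = C A, then
    z h = b h + (z - b) h = (C A S + 1) (z - b) h. *)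
Lemma resolvent_left_inverse b z : principal M A b -> z != 0 ->
    ~ Aspectrum ip M A b z ->
  exists2 L, M L & forall h, L (b h - z *: h) = h.
Proof.
move=> [C MC bE] z0 /contrapT[S [MS _] [_ SE]].
have lC := M_lin MC; have lS := M_lin MS.
exists (- z^-1 *: (C \o (A \o S) + idfun)).
  apply: (M_Z vnM); apply: (M_D vnM); last exact: (M_id vnM).
  by apply: (M_comp vnM) => //; exact: (M_comp vnM).
move=> h; have key : A (S (z *: h - b h)) = A h by rewrite -[in RHS]SE.
rewrite -[LHS]/(- z^-1 *: (C (A (S (b h - z *: h))) + (b h - z *: h))).
rewrite -[in A _]opprB (lopN _ lS) (lopN _ lA) key (lopN _ lC).
rewrite -[C (A h)]/((C \o A) h) -bE addrA addNr sub0r scaleNr -scalerN opprK.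
by rewrite scalerA mulVf // scale1r.
Qed.

Lemma prod_left_inverse b (r : seq R[i]) : M b ->
    (forall z, z \in r -> exists2 L, M L & forall h, L (b h - z *: h) = h) ->
  exists2 L, M L &
    forall h, L (opoly b (\prod_(z <- r) ('X - z%:P)) h) = h.
Proof.
move=> Mb; have lb := M_lin Mb; elim: r => [|z r IH] rL.
  exists idfun => [|h]; first exact: (M_id vnM).
  by rewrite big_nil -polyC1 opolyC scale1r.
have [L ML LE] := IH (fun y yr => rL y (mem_behead (s := z :: r) yr)).
have [L' ML' LE'] := rL z (mem_head _ _).
exists (L \o L') => [|h]; first exact: (M_comp vnM).
by rewrite big_cons (opolyM _ _ _ lb) opolyB (opolyX _ lb) opolyC /= LE'.
Qed.

(** The polynomial f has real coefficients, so that c = f(b) is self-adjoint, and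
    vanishes at 0 and on the A-spectrum.  If c is nonzero and N is the square of
    its norm, f^2 - N takes the value - N at these points; so at its roots z the
    operator b - z has a left inverse, and c^2 - N has one too. *)
Lemma selfadjoint_regular b : principal M A b -> adjoint_of ip b b ->
  exists2 s, M s & forall h, b h = s (b (b h)).
Proof.
move=> Ab ab; have [C MC bE] := Ab.
have Mb : M b by rewrite bE; exact: (M_comp vnM).
have lb := M_lin Mb.
have : finite_set (Aspectrum ip M A b).
  by apply: finA; rewrite bE; exact: (Abounded_compA hs vnM MA A_neq0 posA).
move=> /finite_seqP[r rE].
pose F : {poly R[i]} := 'X * \prod_(z <- r) ('X - z%:P).
pose f := F * map_poly Num.conj F.
have F0 : F != 0.
  by rewrite mulf_neq0 ?polyX_eq0 // monic_neq0 // monic_prod_XsubC.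
have f0 : f != 0 by rewrite mulf_neq0 // map_poly_eq0.
apply: (algebraic_regular vnM Mb ab f0) => h.
suff -> : opoly b f = 0 by [].
have Mf : M (opoly b f) by exact: (M_opoly vnM).
have af : adjoint_of ip (opoly b f) (opoly b f).
  have := adjoint_opoly f lb ab; congr (adjoint_of _ _ (opoly _ _)).
  rewrite rmorphM /= mulrC; congr (_ * _).
  by apply/polyP => i; rewrite !coef_map /= conjCK.
apply: contrapT => fb0.
have [N N0 specN] := norm_square_spectral (M_lin Mf) af (M_bnd hs vnM Mf) fb0.
pose g := f * f - (N%:C)%:P.
have [t gE] := closed_field_poly_normal g.
have NC : - N%:C != 0 :> R[i].
  rewrite oppr_eq0; apply/eqP => /(congr1 (@complex.Re _)) /= NN.
  by rewrite NN ltxx in N0.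
have gF z : F.[z] = 0 -> g.[z] = - N%:C.
  by move=> Fz; rewrite hornerD hornerN (hornerM f) (hornerM F) hornerC Fz !mul0r sub0r.
have g0 : g != 0.
  apply: contraNneq NC => g0; rewrite -(gF 0) ?g0 ?horner0 //.
  by rewrite /F hornerM hornerX mul0r.
have [z|L ML LE] := @prod_left_inverse b t Mb.
  move=> zt; have gz : g.[z] = 0.
    by apply/eqP; rewrite -rootE gE rootZ ?lead_coef_eq0 // root_prod_XsubC.
  have Fz : F.[z] != 0 by apply: contraNneq NC => /gF <-; rewrite gz.
  move: Fz; rewrite /F hornerM hornerX mulf_eq0 negb_or => /andP[z0 Pz].
  apply: resolvent_left_inverse => //; rewrite rE /= => zr.
  by move: Pz; rewrite -rootE root_prod_XsubC zr.
pose k := (lead_coef g)^-1.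
apply: (specN (opoly b f \o (k *: L))) => [|x].
  by apply: (M_bnd hs vnM); apply: (M_comp vnM) => //; exact: (M_Z vnM).
rewrite -[RHS]/(opoly b f (k *: L _)).
rewrite -(opolyM _ _ _ lb) -(opolyC b N%:C) -opolyB -/g [in RHS]gE opolyZ.
by rewrite (lopZ _ _ (M_lin ML)) LE scalerA mulVf ?lead_coef_eq0 // scale1r.
Qed.

(** The support projection of x^* x, for a nonzero x in K. *)
Lemma left_ideal_projection (K : set (H -> H)) : left_ideal M K ->
    K <> [set 0] -> K `<=` principal M A ->
  exists q, [/\ projection ip M q, K q & q <> 0].
Proof.
move=> lK K0 KA; have [a [Ka aa a0]] := left_ideal_square vnM lK K0.
have [s Ms sE] := selfadjoint_regular (KA _ Ka) aa.
have [pq _ _] := support_projection vnM (lideal_sub lK Ka) aa Ms sE.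
exists (s \o a); split=> //; first exact: (lideal_comp lK).
move=> q0; apply: a0; apply/funext => h.
by rewrite sE -[LHS]/((s \o a) (a h)) q0.
Qed.

Definition nonsocle_projection p :=
  [/\ projection ip M p, principal M A p & ~ socle M p].

(** As M p is not minimal, it strictly contains a nonzero left ideal and hence a
    projection q with 0 < q < p.  The projections q and p - q cannot both be in
    the socle; pr.1 is one that is not, and pr.2 is the other. *)
Lemma nonsocle_split p : nonsocle_projection p ->
  exists pr : (H -> H) * (H -> H),
  [/\ nonsocle_projection pr.1 /\ projection ip M pr.2, pr.2 <> 0,
      forall h, p (pr.1 h) = pr.1 h, forall h, p (pr.2 h) = pr.2 h &
      forall h, pr.2 (pr.1 h) = 0].
Proof.
move=> [[Mp ap pp] Ap np]; have lp := M_lin Mp.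
have p0 : p <> 0 by move=> p0; apply: np; rewrite p0; exact: socle_0.
have lP := principal_left_ideal vnM Mp.
have [K [lK Kp K0 KE]] : exists K, [/\ left_ideal M K, K `<=` principal M p,
    K <> [set 0] & K <> principal M p].
  apply: contrapT => nK; apply: np; apply: minimal_socle (principal_self vnM p).
  split=> // [E|K lK Kp].
    by apply: p0; have := principal_self vnM p; rewrite E.
  by apply: contrapT => /not_orP[K0 KE]; apply: nK; exists K.
have KA : K `<=` principal M A.
  move=> _ /Kp[S MS ->]; have [C MC ->] := Ap; exists (S \o C) => //.
  exact: (M_comp vnM).
have [q [[Mq aq qq] Kq q0]] := left_ideal_projection lK K0 KA.
have lq := M_lin Mq.
have qp h : q (p h) = q h by have [S _ ->] := Kp _ Kq; rewrite /= pp.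
have pq h : p (q h) = q h.
  have qpE : q \o p = q by apply/funext.
  have apq : adjoint_of ip q (p \o q) by rewrite -{1}qpE; exact: adjoint_comp.
  by rewrite -[LHS]/((p \o q) h) (adjoint_unique apq aq).
have Mpq : M (p - q) by exact: (M_B vnM).
have pqE h : (p - q) h = p h - q h by [].
have ppq : projection ip M (p - q).
  split=> // [|h]; first exact: adjointB.
  by rewrite !pqE (lopB _ _ lp) (lopB _ _ lq) pp qq pq qp subrr subr0.
have pq0 : p - q <> 0.
  move=> /eqP; rewrite subr_eq0 => /eqP E; apply: KE; apply/seteqP; split=> //.
  by apply: principal_sub lK _; rewrite E.
have absorb x : M x -> (forall h, x (p h) = x h) -> principal M A x.
  move=> Mx xp; have [C MC pE] := Ap; exists (x \o C); first exact: (M_comp vnM).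
  by apply/funext => h; rewrite -xp pE.
have [sq|nq] := pselect (socle M q).
  exists (p - q, q); split=> //=.
  - split=> //; split=> //.
      by apply: absorb => // h; rewrite !pqE pp qp.
    move=> spq; apply: np; have -> : p = (p - q) + q by rewrite subrK.
    exact: socle_D.
  - by move=> h; rewrite !pqE (lopB _ _ lp) pp pq.
  - by move=> h; rewrite pqE (lopB _ _ lq) qq qp subrr.
exists (q, p - q); split=> //=.
- by split=> //; split=> //; exact: absorb.
- by move=> h; rewrite !pqE (lopB _ _ lp) pp pq.
- by move=> h; rewrite pqE pq qq subrr.
Qed.

(** Iterate [nonsocle_split] on the part outside the socle; r n is the part split
    off at stage n. *)
Lemma nonsocle_sequence p : nonsocle_projection p ->
  exists r : nat -> H -> H, [/\ forall n, projection ip M (r n),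
    forall n, r n <> 0, forall n h, p (r n h) = r n h &
    forall m n h, m != n -> r m (r n h) = 0].
Proof.
move=> np.
have /choice[next nextP] : forall q, exists pr : (H -> H) * (H -> H),
    nonsocle_projection q ->
  [/\ nonsocle_projection pr.1 /\ projection ip M pr.2, pr.2 <> 0,
      forall h, q (pr.1 h) = pr.1 h, forall h, q (pr.2 h) = pr.2 h &
      forall h, pr.2 (pr.1 h) = 0].
  move=> q; have [/nonsocle_split[pr prP]|nq] := pselect (nonsocle_projection q).
    by exists pr.
  by exists (q, q).
pose ps n := iter n (fun q => (next q).1) p.
have nps n : nonsocle_projection (ps n).
  by elim: n => //= n /nextP[[]].
pose r n := (next (ps n)).2.
have psr m k h : ps m (ps (m + k)%N h) = ps (m + k)%N h.
  elim: k h => [|k IH] h; first by rewrite addn0; have [[]] := nps m.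
  by rewrite addnS /=; have [_ _ <- _ _] := nextP _ (nps (m + k)%N); rewrite IH.
have pr n : projection ip M (r n) by have [[]] := nextP _ (nps n).
have psrr n h : ps n (r n h) = r n h by have [_ _ _ -> _] := nextP _ (nps n).
have orth m n h : (m < n)%N -> r m (r n h) = 0.
  move=> /subnKC; set k := (n - _)%N => <-; rewrite -[r (_ + k)%N h]psrr -psr.
  by have [_ _ _ _ E] := nextP _ (nps m); exact: E.
exists r; split=> // [n|n h|m n h mn].
- by have [] := nextP _ (nps n).
- by rewrite -psrr; exact: (psr 0).
have [/orth //|nm|/eqP] := ltngtP m n; last by rewrite (negPf mn).
have [_ am _] := pr m; have [Mn an _] := pr n.
apply: (@ip_inj _ _ ip) => x; rewrite linear0r -am -an orth //.
exact: linear0l.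
Qed.

(** The operator T = sum_n 2^-n r_n satisfies T = T p, so it lies in M A and its
    A-spectrum is finite.  But A r_n is nonzero and (2^-n - T) r_n = 0, so every
    2^-n is in it. *)
Lemma nonsocle_projection_false p : nonsocle_projection p -> False.
Proof.
move=> np; have [[Mp ap _] [C MC pE] _] := np.
have [r [pr r0 rp orth]] := nonsocle_sequence np.
pose T := wseries r.
have MT : M T by exact: (M_wseries hs vnM pr).
have rpr n h : r n (p h) = r n h.
  have [_ ar _] := pr n.
  by apply: (@ip_inj _ _ ip) => x; rewrite -ar -ap rp ar.
have TA : T = (T \o C) \o A.
  apply/funext => h; rewrite -[LHS](wseries_absorb hs pr rpr) -/T.
  by rewrite -[T (p h)]/((T \o p) h) pE.
have finT : finite_set (Aspectrum ip M A T).
  apply: finA; rewrite TA; apply: (Abounded_compA hs vnM MA A_neq0 posA).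
  exact: (M_comp vnM).
have sub : setT `<=` (@weight R) @^-1` Aspectrum ip M A T.
  move=> n _ [S [MS _] [_ SE]]; apply: (r0 n); apply/funext => h.
  have key : A (S (weight n *: r n h - T (r n h))) = A (r n h).
    by rewrite -[in RHS]SE.
  rewrite -rp pE /= -key /T (wseries_eigen hs pr orth) subrr.
  by rewrite (lop0 (M_lin MS)) (lop0 lA) (lop0 (M_lin MC)).
apply: infinite_nat; apply: (sub_finite_set sub).
by apply: finite_preimage => // m n _ _; exact: weight_inj.
Qed.

(** The socle is stable under left multiplication and A = A P, where P is the
    support projection of A. *)
Lemma finite_Aspectrum_socle : socle M A.
Proof.
have aA := positive_selfadjoint vnM MA posA.
have [s Ms sE] := selfadjoint_regular (principal_self vnM A) aA.
have [pP _ AsA] := support_projection vnM MA aA Ms sE.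
have [sP|nP] := pselect (socle M (s \o A)); last first.
  by case: (@nonsocle_projection_false (s \o A)); split=> //; exists s.
have -> : A = A \o (s \o A) by apply/funext => h; rewrite /= AsA.
exact: socle_compl.
Qed.

End FiniteSpectrumSocle.

Theorem theorem3p1 (R : realType) (H : completeNormedModType R[i])
    (ip : {dot H for Num.conj}) (M : set (H -> H)) (A : H -> H) :
  hilbert_space ip ->
  von_neumann_algebra ip M ->
  M A -> A <> 0 -> positive_operator ip A ->
  (forall T : H -> H, Abounded ip M A T -> finite_set (Aspectrum ip M A T))
  <-> socle M A.
Proof.
move=> hs vnM MA A0 posA; split=> [finA|sA T bT].
  exact: finite_Aspectrum_socle finA.
exact: socle_finite_Aspectrum bT.
Qed.
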